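(* Let $G$ be an additive group of order $v$, let $H$ be a subgroup of $G$ of order $u$, and let $\mathcal F$ be a resolvable $(G,H,K',1)$-DF. Then $$\mathcal P=\{B+h \mid B\in\mathcal F,\ h\in H\}\ \cup\ \{H\}$$ is a $(G,\underline{u}K'\cup\{u\},u)$-PDF, and $\mathcal P$ is the base parallel class of an HS$(2,K,v)$, where $K$ is the underlying set of the multiset $K'\cup\{u\}$.
   Context: For a multiset $B=\{b_1,\dots,b_k\}$ of elements of an additive group $G$, its list of differences is the multiset $\Delta B=\{b_i-b_j \mid i\neq j\}$; for a collection $\mathcal F$ of multisets, $\Delta\mathcal F$ is the multiset union of the $\Delta B$, $B\in\mathcal F$, and the flatten of $\mathcal F$ is the multiset union of its members. If $H\le G$ and $\Delta\mathcal F$ equals $\lambda$ copies of $G\setminus H$, $\mathcal F$ is a $(G,H,K,\lambda)$-DF (difference family relative to $H$ of index $\lambda$), where $K$ is the multiset of sizes of members of $\mathcal F$; a $(G,K,\lambda)$-DF means $H=\{0\}$. A $(G,H,K,1)$-DF is resolvable if its flatten is a complete system of representatives (each exactly once) of the non-trivial left cosets of $H$ in $G$. A $(G,K,\lambda)$-PDF (partitioned difference family) is a $(G,K,\lambda)$-DF whose blocks partition $G$. For a multiset $K$ and positive integer $n$, $\underline{n}K$ is the multiset union of $n$ copies of $K$. A linear space S$(2,K,v)$ is a set $V$ of $v$ points with a family of blocks (subsets of $V$) whose sizes lie in $K$, every element of $K$ occurring as a block size, such that every 2-subset of $V$ lies in exactly one block. A resolution is a partition of the blocks into parallel classes, each a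 partition of $V$. An HS$(2,K,v)$ (harmonious linear space) is a resolved S$(2,K,v)$ having an automorphism group (a group of permutations of the points preserving the resolution) acting sharply transitively on points and transitively on parallel classes. A PDF $\mathcal P$ in $G$ is said to be the base parallel class of an HS$(2,K,v)$ if the set of translates $\{\mathcal P+g\mid g\in G\}$ is the set of parallel classes of a resolved S$(2,K,v)$ with point set $G$ (so that the translations by elements of $G$ form an automorphism group acting sharply transitively on points and transitively on parallel classes). *)

(* Defs.v *)
From HB Require Import structures.
From mathcomp Require Import all_boot all_fingroup.

Set Implicit Arguments.
Unset Strict Implicit.
Unset Printing Implicit Defensive.

Import GroupScope.

(* Multisets are represented by sequences up to [perm_eq].  Sets K of block
   sizes are also sequences, but used only through membership.  The additive
   group G, which need not be commutative, is the finGroupType gT written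
   multiplicatively: b - c is [b * c^-1], the translate B + g is right
   multiplication by g, and the left cosets x + H are [x *: H]. *)

Definition copies (T : Type) (n : nat) (K : seq T) : seq T :=
  flatten (nseq n K).

Section DifferenceFamilies.

Variable gT : finGroupType.
Implicit Types (B : seq gT) (F P : seq (seq gT)) (H : {group gT}).

(* The indices, not the elements, are required to differ, so a repeated
   element of B contributes the difference 1. *)
Definition differences B : seq gT :=
  [seq nth 1 B ij.1 * (nth 1 B ij.2)^-1
     | ij : 'I_(size B) * 'I_(size B) in [pred ij | ij.1 != ij.2]].

Definition list_differences F : seq gT := flatten (map differences F).

(* Block sizes are positive: the empty multiset is not a block. *)
Definition difference_family H (K : seq nat) (lambda : nat) F : Prop :=
  [/\ 0%N \notin K,
      perm_eq (map size F) K
    & perm_eq (list_differences F) (copies lambda (enum (~: H)))].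

(* Taking C := H in the second condition says that no element of the flatten
   of F lies in H. *)
Definition resolvable_difference_family H (K : seq nat) F : Prop :=
  difference_family H K 1%N F /\
  forall C : {set gT}, C \in lcosets H [set: gT] ->
    count (mem C) (flatten F) = (if C == H then 0%N else 1%N).

Definition partitioned_difference_family (K : seq nat) (lambda : nat) P : Prop :=
  difference_family [1 gT]%G K lambda P /\ perm_eq (flatten P) (enum gT).

End DifferenceFamilies.

Section LinearSpaces.

Variable V : finType.

Definition linear_space (K : seq nat) (v : nat) (Bs : seq {set V}) : Prop :=
  [/\ #|V| = v,
      [seq #|B| | B : {set V} <- Bs] =i K
    & forall x y : V, x != y ->
        count (fun B : {set V} => [set x; y] \subset B) Bs = 1%N].

(* The family of blocks of a resolved space is the multiset union of its
   parallel classes: a block of size 1 may belong to several classes and is then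
   counted once for each of them. *)
Definition blocks_of (R : {set {set {set V}}}) : seq {set V} :=
  flatten [seq enum C | C : {set {set V}} <- enum R].

Definition resolved_linear_space (K : seq nat) (v : nat)
    (R : {set {set {set V}}}) : Prop :=
  (forall C : {set {set V}}, C \in R -> partition C [set: V]) /\
  linear_space K v (blocks_of R).

(* [amove 'P A x y] is the set of all a in A with a x = y. *)
Definition harmonious_linear_space (K : seq nat) (v : nat)
    (A : {group {perm V}}) (R : {set {set {set V}}}) : Prop :=
  [/\ resolved_linear_space K v R,
      [acts A, on R | ('P^*)^*],
      forall x y : V, #|amove 'P A x y| = 1%N
    & [transitive A, on R | ('P^*)^*]].

End LinearSpaces.

Section BaseParallelClass.

Variable gT : finGroupType.

Definition class_of (P : seq (seq gT)) : {set {set gT}} :=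
  [set:: [seq [set:: B] | B : seq gT <- P]].

Definition translates (C : {set {set gT}}) : {set {set {set gT}}} :=
  [set [set B :* g | B in C] | g : gT].

(* The permutations x |-> x * g. *)
Definition translation_group : {group {perm gT}} :=
  (actperm 'R @* [set: gT])%G.

Definition base_parallel_class (K : seq nat) (v : nat) (P : seq (seq gT)) : Prop :=
  harmonious_linear_space K v translation_group (translates (class_of P)).

End BaseParallelClass.

(* Main.v *)
(* Right translation by h does not change the differences b c^-1 of a block, so
   the translates B h contribute #|H| copies of the complement of H, and H itself
   contributes #|H| copies of H minus 1.  Hence over all g in G, a pair of
   distinct points lies in exactly #|H| blocks of the classes P g, counted with
   repetition; as P h = P for h in H, every class is repeated at least #|H| times,
   and so the pair lies in exactly one block of the set of distinct classes. *)
Require Import Defs.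
From HB Require Import structures.
From mathcomp Require Import all_boot all_fingroup.

Set Implicit Arguments.
Unset Strict Implicit.
Unset Printing Implicit Defensive.

Import GroupScope.

(** * Multiplicities in sequences and their flattenings *)

Lemma count_sum (T : Type) (a : pred T) (s : seq T) :
  count a s = \sum_(x <- s) a x.
Proof. by rewrite -sum1_count big_mkcond; apply: eq_bigr => x _; case: (a x). Qed.

Lemma count_flatten_sum (T : Type) (a : pred T) (ss : seq (seq T)) :
  count a (flatten ss) = \sum_(s <- ss) count a s.
Proof. by rewrite count_flatten sumnE big_map. Qed.

Lemma count_copies (T : Type) (a : pred T) n (s : seq T) :
  count a (copies n s) = (n * count a s)%N.
Proof. by rewrite count_flatten_sum big_nseq iter_addn_0 mulnC. Qed.

Lemma mem_copies (T : eqType) n (s : seq T) :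
  0 < n -> copies n s =i s.
Proof.
move=> n0 x; rewrite -!has_pred1 !has_count count_copies muln_gt0.
by rewrite n0.
Qed.

Lemma perm_eq_count_mem (T : eqType) (s t : seq T) :
  (forall x, count_mem x s = count_mem x t) -> perm_eq s t.
Proof. by move=> st; apply/allP => x _; apply/eqP. Qed.

Lemma count_mem_enum (T : finType) (A : {set T}) x :
  count_mem x (enum A) = (x \in A).
Proof. by rewrite count_uniq_mem ?enum_uniq // mem_enum. Qed.

Lemma uniq_flatten_mem (T : eqType) (ss : seq (seq T)) s :
  uniq (flatten ss) -> s \in ss -> uniq s.
Proof.
elim: ss => //= t ss IH; rewrite cat_uniq => /and3P[Ut _ Uss].
by rewrite inE => /predU1P[->|] //; apply: IH.
Qed.

(** Otherwise [x] would occur in the flatten once for [s] and again for [t]. This is how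
    disjointness of the blocks is read off from the flatten. *)
Lemma uniq_flatten_eq (T : eqType) (ss : seq (seq T)) s t x :
  uniq (flatten ss) -> s \in ss -> t \in ss -> x \in s -> x \in t -> s = t.
Proof.
elim: ss => //= r ss IH; rewrite cat_uniq => /and3P[_ /hasPn dis Uss].
have disr s' : s' \in ss -> x \in s' -> x \notin r.
  by move=> ss' s'x; apply: dis; apply/flattenP; exists s'.
rewrite !inE => /predU1P[->|ss_s] /predU1P[->|ss_t] xs xt //.
- by rewrite (negPf (disr _ ss_t xt)) in xs.
- by rewrite (negPf (disr _ ss_s xs)) in xt.
exact: IH.
Qed.

(** A repeated nonempty sequence repeats its first element in the flatten; empty sequences leave no
    trace there, hence the first hypothesis. *)
Lemma uniq_of_flatten (T : eqType) (ss : seq (seq T)) :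
  [::] \notin ss -> uniq (flatten ss) -> uniq ss.
Proof.
elim: ss => //= s ss IH; rewrite inE negb_or cat_uniq => /andP[s0 ss0].
case/and3P=> _ /hasPn dis Uss; rewrite IH // andbT.
apply: contra s0 => ss_s; case: s dis ss_s => //= b s dis ss_s.
have /dis : b \in flatten ss by apply/flattenP; exists (b :: s); rewrite ?mem_head.
by rewrite /= mem_head.
Qed.

(** * Differences of translated blocks, and the partitioned difference family *)

Section Differences.

Variable gT : finGroupType.
Implicit Types (B : seq gT) (F : seq (seq gT)) (H : {group gT}).

Lemma count_differences B (d : gT) : d != 1 ->
  count_mem d (differences B) = \sum_(c <- B) count_mem (d * c)%g B.
Proof.
move=> d1; rewrite /differences count_map -[LHS]sum1_count big_enum_cond /=.
rewrite (eq_bigl (fun ij : 'I_(size B) * 'I_(size B) =>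
   nth 1 B ij.1 == d * nth 1 B ij.2)); last first.
  case=> i j /=; rewrite inE /= (can2_eq (mulgKV _) (mulgK _)) andb_idl //.
  move=> /eqP e; apply: contra d1 => /eqP ij.
  by rewrite -(inj_eq (mulIg (nth 1 B j))) mul1g -e ij.
rewrite big_mkcond /= -(pair_big xpredT xpredT (fun i j : 'I_(size B) =>
   if nth 1 B i == d * nth 1 B j then 1%N else 0%N)) /= exchange_big /=.
rewrite [RHS](big_nth 1) big_mkord; apply: eq_bigr => j _.
rewrite count_sum (big_nth 1) big_mkord; apply: eq_bigr => i _ /=.
by case: eqP.
Qed.

Lemma count_differences1 B : uniq B -> count_mem 1 (differences B) = 0%N.
Proof.
move=> UB; apply/count_memPn/negP => /mapP[[i j]].
rewrite mem_enum inE /= => ij /esym/eqP.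
rewrite -eq_mulgV1 nth_uniq ?ltn_ord //.
by move=> /eqP/val_inj e; rewrite e eqxx in ij.
Qed.

Lemma count_differences_mulr B (d h : gT) : d != 1 ->
  count_mem d (differences [seq b * h | b <- B]) = count_mem d (differences B).
Proof.
move=> d1; rewrite !count_differences // big_map; apply: eq_bigr => c _.
by rewrite count_map; apply: eq_count => b /=; rewrite mulgA (inj_eq (mulIg h)).
Qed.

Lemma count_differences_group H (d : gT) : d != 1 ->
  count_mem d (differences (enum H)) = (#|H| * (d \in H))%N.
Proof.
move=> d1; rewrite count_differences // big_enum /= -sum_nat_const.
by apply: eq_bigr => c Hc; rewrite count_mem_enum groupMr.
Qed.

Lemma count_list_differences F d :
  count_mem d (list_differences F) = \sum_(B <- F) count_mem d (differences B).
Proof. by rewrite count_flatten_sum big_map. Qed.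

(** An entry [b] reaches [x] through [b * h = x] only for [h = b^-1 * x], and this lies in [H]
    exactly when [b] lies in [x *: H]. Right translates by [H] are thus tied to left cosets, the
    ones in the resolvability condition. *)
Lemma count_flatten_translates H F x :
  count_mem x (flatten [seq [seq b * h | b <- B] | B <- F, h <- enum H]) =
  count (mem (x *: H)) (flatten F).
Proof.
rewrite !count_flatten_sum big_allpairs_dep; apply: eq_bigr => B _.
rewrite big_enum /= count_sum.
under eq_bigr => h _ do rewrite count_map count_sum.
rewrite exchange_big /=; apply: eq_bigr => b _.
rewrite mem_lcoset -groupV invMg invgK.
under eq_bigr => h _ do rewrite /= -(inj_eq (mulgI b^-1)) mulKg.
have [Hbx|nHbx] := boolP (_ \in H).
  by rewrite (bigD1 (b^-1 * x)) //= eqxx big1 ?addn0 // => h /andP[_ /negPf->].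
rewrite big1 // => h Hh; apply/eqP; rewrite eqb0.
by apply: contra nHbx => /eqP <-.
Qed.

(** The partition comes first, since it also shows that the blocks are free of repetitions. A point
    outside [H] is covered once by the translates because its left coset holds one entry of [F]; the
    points of [H] are covered by the block [H] alone. *)
Lemma resolvable_translates_pdf H K F :
  resolvable_difference_family H K F ->
  partitioned_difference_family (copies #|H| K ++ [:: #|H|]) #|H|
    ([seq [seq b * h | b <- B] | B <- F, h <- enum H] ++ [:: enum H]).
Proof.
set T := [seq _ | B <- F, h <- enum H] => -[[K0 sizeF diffF] resF].
have part : perm_eq (flatten (T ++ [:: enum H])) (enum gT).
  apply: perm_eq_count_mem => x; rewrite flatten_cat count_cat /= cats0.
  rewrite count_flatten_translates resF; last by apply/lcosetsP; exists x.
  rewrite count_mem_enum count_uniq_mem ?enum_uniq // mem_enum inE.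
  have -> : (x *: H == H) = (x \in H).
    apply/eqP/idP => [<-|/lcoset_id//]; exact: lcoset_refl.
  by case: (x \in H).
split=> //; split.
- rewrite mem_cat mem_copies ?cardG_gt0 // negb_or K0 inE eq_sym.
  by rewrite -lt0n cardG_gt0.
- apply/seq.permP => a; rewrite map_cat !count_cat /= -cardE; congr addn.
  rewrite count_copies -(seq.permP sizeF) !count_map !count_sum big_allpairs_dep.
  rewrite big_distrr; apply: eq_bigr => B _ /=.
  by under eq_bigr => h _ do rewrite size_map; rewrite big_enum sum_nat_const.
apply: perm_eq_count_mem => d; rewrite count_list_differences count_copies.
rewrite count_mem_enum !inE; have [->|d1] := eqVneq d 1.
  (* The difference 1 could only come from a repeated element inside a block. *)
  rewrite muln0 big_seq big1 // => B /uniq_flatten_mem UB.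
  by apply/count_differences1/UB; rewrite (perm_uniq part) enum_uniq.
rewrite big_cat big_seq1 count_differences_group // big_allpairs_dep /=.
under eq_bigr => B _.
  under eq_bigr => h _ do rewrite count_differences_mulr //.
  rewrite big_enum sum_nat_const; over.
(* The translates give [#|H|] when [d] is outside [H] and 0 otherwise; the block [H] gives the
   complementary amount. *)
rewrite -big_distrr -count_list_differences (seq.permP diffF) count_copies /=.
by rewrite count_mem_enum inE mul1n -mulnDr; case: (d \in H).
Qed.

End Differences.

(** * Translates of the base class, and the resolved linear space they form *)

Section BaseClass.

Variable gT : finGroupType.
Implicit Types (C : {set {set gT}}) (P : seq (seq gT)) (H : {group gT}).

Definition translate C g := [set B :* g | B in C].

Lemma translateM C g h : translate (translate C g) h = translate C (g * h).
Proof.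
by rewrite /translate -imset_comp; apply: eq_imset => B /=; rewrite rcosetM.
Qed.

Lemma translate1 C : translate C 1 = C.
Proof.
rewrite /translate -[RHS]imset_id; apply: eq_imset => B.
exact: rcoset1.
Qed.

Lemma translatesP C D : reflect (exists g, D = translate C g) (D \in translates C).
Proof. by apply: (iffP imsetP) => [[g _]|[g]] ->; exists g. Qed.

(** The point action is lifted twice, to blocks and then to classes, so both levels of [setact]
    unfold to images. *)
Lemma setact_translation g C :
  ('P^*)^*%act C (actperm 'R g) = translate C g.
Proof.
rewrite /= /setact; apply: eq_imset => B.
rewrite /= /setact -rcosetE; apply: eq_imset => x.
by rewrite /= /aperm permE.
Qed.

Lemma translation_groupP a :
  reflect (exists g, a = actperm 'R g) (a \in translation_group gT).
Proof.
apply: (iffP morphimP) => [[g _ _ ->]|[g ->]]; first by exists g.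
by exists g; rewrite ?inE.
Qed.

Lemma partition_translate C g :
  partition C [set: gT] -> partition (translate C g) [set: gT].
Proof.
rewrite -(imset_partition _ _ (mulIg g)) => pC.
have <- : [set y * g | y in [set: gT]] = [set: gT].
  apply/setP => x; rewrite inE; apply/imsetP.
  by exists (x * g^-1); rewrite ?inE ?mulgKV.
rewrite /translate; under eq_imset => B do rewrite -rcosetE.
exact: pC.
Qed.

Lemma partition_class_of P :
  [::] \notin P -> perm_eq (flatten P) (enum gT) ->
  partition (class_of P) [set: gT].
Proof.
move=> P0 part; apply/and3P; split.
- apply/eqP/setP => x; rewrite inE; apply/bigcupP.
  have /flattenP[B PB Bx] : x \in flatten P by rewrite (perm_mem part) mem_enum.
  by exists [set:: B]; rewrite inE // map_f.
- apply/trivIsetP => A A'; rewrite !inE => /mapP[B PB ->] /mapP[B' PB' ->].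
  apply: contraR => /pred0Pn[x /=]; rewrite !inE => /andP[Bx B'x].
  rewrite (uniq_flatten_eq _ PB PB' Bx B'x) //.
  by rewrite (perm_uniq part) enum_uniq.
rewrite inE; apply/mapP => -[[|b B] PB]; first by rewrite PB in P0.
by move/setP/(_ b); rewrite !inE eqxx.
Qed.

(** Nonempty disjoint blocks have distinct underlying sets, so no two blocks merge when the sequence
    [P] becomes a set of sets. *)
Lemma sum_class_of P (f : {set gT} -> nat) :
  [::] \notin P -> uniq (flatten P) ->
  \sum_(B in class_of P) f B = \sum_(B <- P) f [set:: B].
Proof.
move=> P0 UP; rewrite -(big_map (fun B => [set:: B]) xpredT f) big_uniq /=.
  by apply: eq_bigl => B; rewrite inE.
rewrite map_inj_in_uniq ?uniq_of_flatten // => B B' PB PB' /setP eB.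
case: B PB eB => [|b B] PB eB; first by rewrite PB in P0.
apply: (uniq_flatten_eq UP PB PB' (mem_head b B)).
by move: (eB b); rewrite !inE eqxx /= => <-.
Qed.

Lemma sum_translate C g (f : {set gT} -> nat) :
  \sum_(B in translate C g) f B = \sum_(B in C) f (B :* g).
Proof.
rewrite big_imset //= => B B' _ _ eB.
by rewrite -(rcosetK g B) eB rcosetK.
Qed.

(** The pair lies in [B :* g] iff [x * g^-1] and [y * g^-1] both lie in [B]. These two elements have
    difference [x * y^-1] whatever [g] is, so each occurrence of that difference in [B] corresponds
    to one [g]. *)
Lemma sum_translates_pair P x y :
  [::] \notin P -> uniq (flatten P) -> x != y ->
  \sum_g \sum_(B in translate (class_of P) g) ([set x; y] \subset B) =
  count_mem (x * y^-1)%g (list_differences P).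
Proof.
move=> P0 UP xy; have d1 : x * y^-1 != 1 by rewrite -eq_mulgV1.
under eq_bigr => g _ do rewrite sum_translate sum_class_of //.
rewrite exchange_big count_list_differences big_seq [RHS]big_seq /=.
apply: eq_bigr => B PB; have UB := uniq_flatten_mem UP PB.
rewrite count_differences // [RHS]big_uniq // [RHS]big_mkcond /=.
(* Substitutes [g = c^-1 * y], so that [c = y * g^-1] is the second entry of the pair in [B]. *)
rewrite (reindex_inj (inj_comp (mulIg y) invg_inj)); apply: eq_bigr => c _ /=.
rewrite subUset !sub1set !mem_rcoset invMg invgK !inE mulgA mulKVg.
rewrite count_uniq_mem // andbC.
by case: (c \in B).
Qed.

Lemma mem_blocks_of (R : {set {set {set gT}}}) B :
  reflect (exists2 D, D \in R & B \in D) (B \in blocks_of R).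
Proof.
apply: (iffP flattenP) => [[_ /mapP[D + ->]]|[D RD DB]].
  by rewrite !mem_enum => RD DB; exists D.
by exists (enum D); rewrite ?mem_enum //; apply: map_f; rewrite mem_enum.
Qed.

Lemma count_blocks_of (R : {set {set {set gT}}}) (a : pred {set gT}) :
  count a (blocks_of R) = \sum_(D in R) \sum_(B in D) a B.
Proof.
rewrite count_flatten_sum big_map big_enum /=.
by apply: eq_bigr => D _; rewrite count_sum big_enum.
Qed.

Lemma count_blocks_pair H K P x y :
  partitioned_difference_family K #|H| P ->
  {in H, forall h, translate (class_of P) h = class_of P} -> x != y ->
  count (fun B : {set gT} => [set x; y] \subset B)
    (blocks_of (translates (class_of P))) = 1%N.
Proof.
move=> [[K0 sizeP diffP] part] stabP xy.
have UP : uniq (flatten P) by rewrite (perm_uniq part) enum_uniq.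
have P0 : [::] \notin P.
  by apply: contra K0 => /(map_f size); rewrite (perm_mem sizeP).
have := sum_translates_pair P0 UP xy.
rewrite (seq.permP diffP) count_copies count_mem_enum !inE -eq_mulgV1 xy muln1.
set C := class_of P; rewrite count_blocks_of.
set N := fun D : {set {set gT}} => \sum_(B in D) ([set x; y] \subset B).
rewrite -[X in X = #|H|]/(\sum_g N (translate C g)).
rewrite -[X in X = 1%N]/(\sum_(D in translates C) N D).
(* Groups the elements [g] by the class they produce, each distinct class being weighted by the size
   of its fibre. *)
have -> : \sum_g N (translate C g) =
    \sum_(D in translates C) #|[pred g | translate C g == D]| * N D.
  rewrite (partition_big (translate C) (mem (translates C))); last first.
    by move=> g _; apply/translatesP; exists g.
  apply: eq_bigr => D _; rewrite -sum_nat_const.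
  by apply: eq_big => g //= /eqP->.
move=> sumH; apply/eqP; rewrite eqn_leq; apply/andP; split.
  (* At most one block: the fibre over [translate C g] contains the coset [H :* g], so every weight
     is at least [#|H|], while the weighted sum equals [#|H|]. *)
  rewrite -(leq_pmul2l (cardG_gt0 H)) muln1 -[X in _ <= X]sumH big_distrr.
  apply: leq_sum => _ /translatesP[g ->]; rewrite leq_mul2r orbC.
  apply/orP; left; rewrite -(card_rcoset H g); apply: subset_leq_card.
  apply/subsetP => _ /rcosetP[h Hh ->].
  by rewrite inE /= -translateM stabP.
(* At least one block: otherwise the weighted sum would vanish, yet it equals [#|H|], which is
   positive. *)
rewrite lt0n; apply: contraTneq (cardG_gt0 H) => /eqP.
rewrite sum_nat_eq0 => /forall_inP N0.
by rewrite -sumH big1 // => D /N0/eqP->; rewrite muln0.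
Qed.

(** Translation preserves partitions and block sizes, so the sizes are those of [P], all of them
    already present in the class with [g = 1]. *)
Lemma translates_resolved H K K2 P :
  partitioned_difference_family K #|H| P -> K =i K2 ->
  {in H, forall h, translate (class_of P) h = class_of P} ->
  resolved_linear_space K2 #|gT| (translates (class_of P)).
Proof.
move=> pdf KK2 stabP; have [[K0 sizeP diffP] part] := pdf.
have UP : uniq (flatten P) by rewrite (perm_uniq part) enum_uniq.
have P0 : [::] \notin P.
  by apply: contra K0 => /(map_f size); rewrite (perm_mem sizeP).
have card_block B : B \in P -> #|[set:: B]| = size B.
  by move=> PB; rewrite cardsE; apply/card_uniqP/(uniq_flatten_mem UP PB).
split=> [_ /translatesP[g ->]|].
  exact/partition_translate/partition_class_of.
split=> // [n|x y xy]; last exact: count_blocks_pair pdf stabP xy.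
rewrite -KK2 -(perm_mem sizeP); apply/mapP/mapP => [[B]|[B PB ->]].
  case/mem_blocks_of => _ /translatesP[g ->] /imsetP[B'].
  rewrite inE => /mapP[B0 PB0 ->] -> ->.
  by exists B0; rewrite // card_rcoset card_block.
exists [set:: B]; last by rewrite card_block.
apply/mem_blocks_of; exists (class_of P); last by rewrite inE map_f.
by apply/translatesP; exists 1; rewrite translate1.
Qed.

Lemma translation_group_amove (x y : gT) :
  #|amove 'P (translation_group gT) x y| = 1%N.
Proof.
apply/eqP/cards1P; exists (actperm 'R (x^-1 * y)).
apply/setP => a; rewrite !inE; apply/andP/eqP => [[]|->].
  case/translation_groupP => g ->; rewrite /= /aperm permE /= => /eqP <-.
  by rewrite mulKg.
split; first by apply/translation_groupP; exists (x^-1 * y).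
by rewrite /= /aperm permE /= mulKVg.
Qed.

Lemma translation_group_trans C :
  [transitive translation_group gT, on translates C | ('P^*)^*].
Proof.
apply/imsetP; exists C; first by apply/translatesP; exists 1; rewrite translate1.
apply/setP => D; apply/translatesP/orbitP => [[g ->]|[a]].
  exists (actperm 'R g); last exact: setact_translation.
  by apply/translation_groupP; exists g.
by case/translation_groupP => g -> <-; exists g; rewrite setact_translation.
Qed.

(** Isolates what the construction must supply: a partitioned difference family of index [#|H|]
    whose class is fixed by the translations from [H]. *)
Lemma pdf_base_parallel_class H K K2 P :
  partitioned_difference_family K #|H| P -> K =i K2 ->
  {in H, forall h, translate (class_of P) h = class_of P} ->
  base_parallel_class K2 #|gT| P.
Proof.
move=> pdf KK2 stabP; have trans := translation_group_trans (class_of P).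
split=> //; first exact: translates_resolved pdf KK2 stabP.
  exact: atrans_acts.
exact: translation_group_amove.
Qed.

End BaseClass.

(** Translation by [h] sends the translate of a block by [k] to its translate by [k * h], and fixes
    [H]. *)
Lemma class_of_translates_stable (gT : finGroupType) (H : {group gT})
    (F : seq (seq gT)) (h : gT) : h \in H ->
  let P := [seq [seq b * k | b <- B] | B <- F, k <- enum H] ++ [:: enum H] in
  translate (class_of P) h = class_of P.
Proof.
(* Translation is injective on blocks, so both sides have the same cardinality and one inclusion
   suffices. *)
move=> Hh P; apply/eqP; rewrite eqEcard card_imset ?leqnn ?andbT; last first.
  by move=> B B' eB; rewrite -(rcosetK h B) eB rcosetK.
apply/subsetP => _ /imsetP[B + ->]; rewrite !inE !map_cat !mem_cat.
case/orP => [/mapP[_ /allpairsP[[B0 k] /= [FB0 Hk ->]] ->]|].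
  apply/orP; left; apply/mapP; exists [seq b * (k * h) | b <- B0].
    apply/allpairsP; exists (B0, k * h) => /=; split=> //.
    by rewrite mem_enum in Hk; rewrite mem_enum groupM.
  have -> : [seq b * (k * h) | b <- B0] = [seq b * h | b <- [seq b * k | b <- B0]].
    by rewrite -map_comp; apply: eq_map => b /=; rewrite mulgA.
  apply/setP => x; rewrite mem_rcoset !inE -{2}(mulgKV h x).
  by rewrite (mem_map (mulIg h)).
rewrite inE => /eqP ->; apply/orP; right; rewrite inE.
by rewrite set_enum rcoset_id.
Qed.

Theorem theorem2p4 (gT : finGroupType) (H : {group gT}) (v u : nat)
    (K' : seq nat) (F : seq (seq gT)) :
  #|gT| = v -> #|H| = u ->
  resolvable_difference_family H K' F ->
  let P : seq (seq gT) :=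
    [seq [seq b * h | b <- B] | B <- F, h <- enum H] ++ [:: enum H] in
  partitioned_difference_family (copies u K' ++ [:: u]) u P /\
  base_parallel_class (undup (K' ++ [:: u])) v P.
Proof.
move=> <- <- /resolvable_translates_pdf pdf P; split=> //.
apply: pdf_base_parallel_class pdf _ _ => [n|h Hh].
  (* Since [#|H|] is positive, taking that many copies of [K'] does not change its set of
     members. *)
  by rewrite mem_undup !mem_cat mem_copies ?cardG_gt0.
exact: class_of_translates_stable.
Qed.
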